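(* Let $\alpha\in(0,1)$, $\tau>0$, $N\in\mathbb{N}$, $\lambda_0,\lambda_1\ge0$, and let $F_1,F_2$ be nonnegative constants (possibly depending on $\tau$). Let $\{y^n\}_{0\le n\le N}$ and $\{F^n\}_{0\le n\le N}$ be nonnegative sequences satisfying, for all $1\le n\le N$, $$\partial_\tau^\alpha y^n\le\lambda_0y^n+\lambda_1y^{n-1}+F^n\qquad\text{and}\qquad\frac{\tau^\alpha}{\Gamma(\alpha)}\sum_{k=0}^{n-1}(n-k)^{\alpha-1}F^{k+1}\le F_1+t_n^{\alpha-1}F_2,$$ where $\partial_\tau^\alpha$ is either the L1 discrete Riemann–Liouville derivative ${}^{RL}\partial_\tau^\alpha$ or the L1 discrete Caputo derivative ${}^{C}\partial_\tau^\alpha$, and $t_n=\tau n$. Let $\tau_0,M>0$ be such that $$\tau_0<(\lambda_0\Gamma(2-\alpha))^{-1/\alpha},\qquad M=\frac{\Gamma(\alpha)\Gamma(2-\alpha)}{1-\lambda_0\tau_0^\alpha\Gamma(2-\alpha)} .$$ Then, if $\tau<\tau_0$, the following hold for all $0\le n\le N$: (a) (Riemann–Liouville) If $\partial_\tau^\alpha={}^{RL}\partial_\tau^\alpha$, then $$y^n\le(y^0\tau^{1-\alpha}+MF_2)\,\Gamma(\alpha)E_{\alpha,\alpha}(2\max\{\lambda_0,\lambda_1\}Mt_n^\alpha)\,t_n^{\alpha-1}+M\,E_\alpha(2\max\{\lambda_0,\lambda_1\}Mt_n^\alpha)\,F_1 .$$ (b) (Caputo) If $\partial_\tau^\alpha={}^{C}\partial_\tau^\alpha$,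 then $$y^n\le M\,\Gamma(\alpha)E_{\alpha,\alpha}(2\max\{\lambda_0,\lambda_1\}Mt_n^\alpha)\,F_2\,t_n^{\alpha-1}+\frac{E_\alpha(2\max\{\lambda_0,\lambda_1\}Mt_n^\alpha)}{1-\lambda_0\tau_0^\alpha\Gamma(2-\alpha)}\left(y^0+\Gamma(\alpha)\Gamma(2-\alpha)F_1\right).$$
   Context: With $b_i=(i+1)^{1-\alpha}-i^{1-\alpha}$, for $n\ge1$: ${}^{C}\partial_\tau^\alpha f^n=\frac{\tau^{-\alpha}}{\Gamma(2-\alpha)}\Big(f^n-b_{n-1}f^0-\sum_{k=1}^{n-1}(b_{n-k-1}-b_{n-k})f^k\Big)$, ${}^{RL}\partial_\tau^\alpha f^n=\frac{\tau^{-\alpha}}{\Gamma(2-\alpha)}\Big(f^n-\sum_{k=0}^{n-1}(b_{n-k-1}-b_{n-k})f^k\Big)$. Mittag-Leffler functions: $E_{\alpha,\beta}(z)=\sum_{k=0}^\infty\frac{z^k}{\Gamma(\alpha k+\beta)}$, $E_\alpha=E_{\alpha,1}$. Conventions: $(\lambda_0\Gamma(2-\alpha))^{-1/\alpha}=+\infty$ if $\lambda_0=0$; $t_n^{\alpha-1}=\tau^{\alpha-1}n^{\alpha-1}$ with $0^{\alpha-1}=1$ (so $t_0^{\alpha-1}$ means $\tau^{\alpha-1}$). *)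

(* Defs.v *)
From HB Require Import structures.
From mathcomp Require Import all_boot all_order all_algebra.
From mathcomp Require Import all_classical all_reals all_analysis.

Set Implicit Arguments.
Unset Strict Implicit.
Unset Printing Implicit Defensive.

Import Order.TTheory GRing.Theory Num.Theory.
Import numFieldNormedType.Exports.

Local Open Scope classical_set_scope.
Local Open Scope ring_scope.

(* Euler's integral; the defining integral converges only for [0 < x]. *)
Definition Gamma (R : realType) (x : R) : R :=
  \int[lebesgue_measure]_(t in `]0, +oo[) (t `^ (x - 1) * expR (- t)).

(* Mittag-Leffler function $E_{\alpha,\beta}$ at a real argument. *)
Definition mittag_leffler (R : realType) (alpha beta z : R) : R :=
  limn (series (fun k : nat => z ^+ k / Gamma (alpha * k%:R + beta))).

Definition L1_weight (R : realType) (alpha : R) (i : nat) : R :=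
  i.+1%:R `^ (1 - alpha) - i%:R `^ (1 - alpha).

(* The two L1 derivatives are meant for [1 <= n] only. *)
Definition L1_Caputo (R : realType) (alpha tau : R) (f : nat -> R) (n : nat) : R :=
  let b := L1_weight alpha in
  tau `^ (- alpha) / Gamma (2 - alpha) *
    (f n - b (n - 1)%N * f 0%N
     - \sum_(1 <= k < n) (b (n - k - 1)%N - b (n - k)%N) * f k).

Definition L1_RL (R : realType) (alpha tau : R) (f : nat -> R) (n : nat) : R :=
  let b := L1_weight alpha in
  tau `^ (- alpha) / Gamma (2 - alpha) *
    (f n - \sum_(0 <= k < n) (b (n - k - 1)%N - b (n - k)%N) * f k).

Definition grid (R : realType) (tau : R) (n : nat) : R := tau * n%:R.

(* $t_n^{\alpha-1}$ under the convention $0^{\alpha-1} = 1$, so that its value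
   at [n = 0] is $\tau^{\alpha-1}$; note that [0 `^ (alpha - 1) = 0] when
   [alpha != 1], so [grid tau n `^ (alpha - 1)] would be wrong there. *)
Definition grid_pow (R : realType) (alpha tau : R) (n : nat) : R :=
  tau `^ (alpha - 1) * (if n == 0%N then 1 else n%:R `^ (alpha - 1)).

(* $(\lambda_0 \Gamma(2-\alpha))^{-1/\alpha}$, read as $+\infty$ when
   $\lambda_0 = 0$ (where [powR] would return 0). *)
Definition step_bound (R : realType) (alpha lambda0 : R) : \bar R :=
  if lambda0 == 0 then +oo%E
  else ((lambda0 * Gamma (2 - alpha)) `^ (- 1 / alpha))%:E.

(* Main.v *)
Require Import Defs.
From HB Require Import structures.
From mathcomp Require Import all_boot all_order all_algebra.
From mathcomp Require Import all_classical all_reals all_analysis.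
From mathcomp Require Import measurable_realfun ring lra.

Set Implicit Arguments.
Unset Strict Implicit.
Unset Printing Implicit Defensive.

Import Order.TTheory GRing.Theory Num.Theory.
Import numFieldNormedType.Exports.

Local Open Scope ring_scope.

(* Convolving the difference inequality with the reciprocal [P] of the power
   series of the L1 difference operator turns it into a weakly singular discrete
   Volterra inequality.  The weights are log-convex, so [P] is nonincreasing
   (Kaluza), and [P n * sum_(k <= n) b k <= 1] gives [P n <= (n+1)^(alpha-1)].
   The Volterra inequality is then iterated: each iterate is a term of the
   Mittag-Leffler series, by the bound
     Gamma (a + b) * sum_(j < n) (n - j)^(a-1) * j^(b-1)
       <= Gamma a * Gamma b * n^(a+b-1),
   that is, the Riemann sum is at most the Beta integral: left endpoints do for
   [1 <= b], and midpoints, with convexity of the integrand, for [b < 1]. *)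

Definition pos_powR (R : realType) (a t : R) : R :=
  if 0 < t then t `^ (a - 1) else 0.

Lemma pos_powR_ge0 (R : realType) (a t : R) : 0 <= pos_powR a t.
Proof. by rewrite /pos_powR; case: ifP => // _; exact: powR_ge0. Qed.

Lemma measurable_pos_powR (R : realType) (a : R) :
  measurable_fun [set: R] (pos_powR a).
Proof. by apply: measurable_fun_ifT => //; exact: measurable_fun_ltr. Qed.

Lemma lebesgue_measure_shift (R : realType) (c : R) (A : set R) :
  measurable A ->
  pushforward lebesgue_measure (fun x : measurableTypeR R => x + c) A
    = lebesgue_measure A.
Proof.
move=> mA.
have mf : measurable_fun [set: measurableTypeR R]
    (fun x : measurableTypeR R => (x + c : measurableTypeR R)).
  exact: measurable_funD.
pose f : {mfun measurableTypeR R >-> measurableTypeR R} :=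
  HB.pack (fun x : measurableTypeR R => (x + c : measurableTypeR R))
    (isMeasurableFun.Build _ _ _ _ _ mf).
apply/esym/(@lebesgue_measure_unique _ (pushforward lebesgue_measure f)) => //.
move=> _ [[a b]] _ <-; rewrite /pushforward.
have fE : (f @^-1` `]a, b])%classic = `]a - c, b - c]%classic.
  rewrite /f/=; apply/seteqP; split => x /=; rewrite !in_itv/=; lra.
transitivity (lebesgue_measure `]a - c, b - c]%classic); last first.
  exact: esym (congr1 lebesgue_measure fE).
rewrite !lebesgue_measure_itv/= !lte_fin ltrD2r.
by case: ifP => // _; rewrite -!EFinB; congr (_%:E); lra.
Qed.

Lemma ge0_integral_shift (R : realType) (c : R) (f : R -> \bar R) :
  measurable_fun [set: R] f -> (forall x, 0 <= f x)%E ->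
  (\int[lebesgue_measure]_x f x = \int[lebesgue_measure]_x f (x + c)%R)%E.
Proof.
move=> mf f0.
have mc : measurable_fun [set: measurableTypeR R]
    (fun x : measurableTypeR R => (x + c : measurableTypeR R)).
  exact: measurable_funD.
rewrite -(@ge0_integral_pushforward _ _ _ _ R _ mc lebesgue_measure setT f)//.
by apply: eq_measure_integral => //= A mA _; exact/esym/lebesgue_measure_shift.
Qed.

Lemma integral_itv0y_pos_powR (R : realType) (a : R) :
  (\int[lebesgue_measure]_(t in `]0%R, +oo[) (t `^ (a - 1) * expR (- t))%:E
   = \int[lebesgue_measure]_t (pos_powR a t * expR (- t))%:E)%E.
Proof.
rewrite integral_mkcond; apply: eq_integral => t _.
rewrite patchE /pos_powR mem_setE in_itv/= andbT; case: ifP => // _.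
by rewrite mul0r.
Qed.

Lemma ge0_integral_powR_itv0c (R : realType) (a b : R) : 0 < a -> 0 < b ->
  (\int[lebesgue_measure]_(t in `]0%R, b]) (t `^ (a - 1))%:E < +oo)%E.
Proof.
move=> a0 b0.
pose F (n : nat) : set R := `[b / n.+2%:R, b]%classic.
have F0 n : 0 < b / n.+2%:R by rewrite divr_gt0.
have Fb n : b / n.+2%:R < b by rewrite ltr_pdivrMr// ltr_pMr// ltr1n.
have -> : `]0%R, b]%classic = (\bigcup_n F n)%classic.
  apply/seteqP; split => x /=; rewrite in_itv/=.
    move=> /andP[x0 xb]; exists (Num.truncn (b / x)) => //=.
    rewrite /F/= in_itv/= xb andbT ler_pdivrMr// mulrC -ler_pdivrMr//.
    apply/ltW/(lt_trans (Num.Theory.truncnS_gt _)).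
    by rewrite ltr_nat.
  by move=> [n _]; rewrite /F/= in_itv/= => /andP[/(lt_le_trans (F0 n)) -> ->].
have ndF : nondecreasing_seq F.
  move=> m n mn; rewrite subsetEset => x; rewrite /F/= !in_itv/= => /andP[h ->].
  rewrite andbT; apply: le_trans h; rewrite ler_pM2l// lef_pV2 ?posrE// ler_nat.
  by rewrite !ltnS.
have := @ge0_nondecreasing_set_cvg_integral _ (measurableTypeR R) R F
  (fun t => (t `^ (a - 1))%:E) lebesgue_measure ndF.
move=> /(_ (fun _ => measurable_itv _)) /(_ _ _)/cvg_lim <-//; first last.
- by move=> i x _; rewrite lee_fin powR_ge0.
- by move=> i; apply/measurable_EFinP/measurable_funTS.
apply: (@le_lt_trans _ _ (b `^ a / a)%:E); last by rewrite ltry.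
apply: lime_le.
  apply: ereal_nondecreasing_is_cvgn.
  apply: ge0_nondecreasing_set_nondecreasing_integral => //.
  - by move=> i; exact: measurable_itv.
  - by move=> i; apply/measurable_EFinP/measurable_funTS.
  - by move=> i x _; rewrite lee_fin powR_ge0.
apply: nearW => n; rewrite /F.
have cp (p x : R) : 0 < x -> {for x, continuous (@powR R ^~ p)}.
  move=> x0; apply: differentiable_continuous; apply/derivable1_diffP.
  by apply: derivable_powR; rewrite in_itv/= andbT.
have cpa : {for b / n.+2%:R, continuous (fun t => a^-1 * t `^ a)}.
  by apply: cvgM; [exact: cvg_cst|exact: cp].
have cpb : {for b, continuous (fun t => a^-1 * t `^ a)}.
  by apply: cvgM; [exact: cvg_cst|exact: cp].
rewrite (@continuous_FTC2 _ _ (fun t => a^-1 * t `^ a))//.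
- rewrite -EFinB lee_fin mulrC lerBlDr lerDl mulr_ge0 ?powR_ge0//.
  by rewrite invr_ge0 ltW.
- apply: continuous_in_subspaceT => x; rewrite inE/= in_itv/= => /andP[h _].
  exact/cp/(lt_le_trans (F0 n)).
- split.
  + move=> x; rewrite in_itv/= => /andP[h _]; apply: derivableM => //.
    by apply: derivable_powR; rewrite in_itv/= andbT (lt_trans (F0 n)).
  + exact: cvg_at_right_filter.
  + exact: cvg_at_left_filter.
- move=> x; rewrite in_itv/= => /andP[h _].
  have x0 : 0 < x by rewrite (lt_trans (F0 n)).
  rewrite derive1Ml; last by apply: derivable_powR; rewrite in_itv/= andbT.
  by rewrite powR_derive1 ?in_itv/= ?andbT// mulrA mulVf ?mul1r// gt_eqF.
Qed.

Lemma measurable_Gamma_integrand (R : realType) (D : set R) (a : R) :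
  measurable_fun D (fun t : R => (t `^ (a - 1) * expR (- t))%:E).
Proof.
apply/measurable_EFinP/measurable_funTS; apply: measurable_funM => //.
by apply: measurableT_comp => //; exact: measurableT_comp.
Qed.

Lemma powR_mul_expRN_le (R : realType) (a t : R) : 0 < a -> 1 <= t ->
  t `^ (a - 1) * expR (- t) <= expR (a * ln (2 * a)) * expR (- t / 2).
Proof.
move=> a0 t1; have t0 : 0 < t by rewrite (lt_le_trans ltr01).
rewrite /powR gt_eqF// -!expRD ler_expR.
have lnt : 0 <= ln t by rewrite ln_ge0.
have a20 : 0 < 2 * a by rewrite mulr_gt0.
have : ln t <= t / (2 * a) + ln (2 * a).
  rewrite -lerBlDr -ln_div ?posrE//.
  exact/ltW/ln_sublinear/divr_gt0.
move=> /(ler_wpM2l (ltW a0)).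
have -> : a * (t / (2 * a) + ln (2 * a)) = t / 2 + a * ln (2 * a).
  by field; rewrite gt_eqF.
nra.
Qed.

Lemma Gamma_integral_lty (R : realType) (a : R) : 0 < a ->
  (\int[lebesgue_measure]_(t in `]0%R, +oo[)
     (t `^ (a - 1) * expR (- t))%:E < +oo)%E.
Proof.
move=> a0.
have h0 t : 0 <= t `^ (a - 1) * expR (- t) by rewrite mulr_ge0 ?powR_ge0 ?expR_ge0.
have -> : `]0%R, +oo[%classic = (`]0%R, 1%R] `|` `]1%R, +oo[ : set R)%classic.
  apply/seteqP; split => x /=; rewrite !in_itv/= ?andbT.
    by move=> x0; case: (leP x 1) => x1; [left; rewrite x0|right].
  by case=> [/andP[]//|]; apply: lt_trans.
rewrite ge0_integral_setU//=; last 3 first.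
- exact: measurable_Gamma_integrand.
- by move=> t _; rewrite lee_fin.
- apply/eqP; rewrite -subset0 => x /= []; rewrite !in_itv/= andbT.
  by move=> /andP[_ /le_lt_trans h] /h; rewrite ltxx.
apply: lte_add_pinfty.
  apply: le_lt_trans (ge0_integral_powR_itv0c a0 ltr01).
  apply: ge0_le_integral => //=.
  - by move=> t _; rewrite lee_fin.
  - exact: measurable_Gamma_integrand.
  - by apply/measurable_EFinP/measurable_funTS.
  - move=> t; rewrite in_itv/= => /andP[t0 _].
    by rewrite lee_fin ler_piMr ?powR_ge0// -expR0 ler_expR oppr_le0 ltW.
have c0 : 0 <= 2 * expR (a * ln (2 * a)) by rewrite mulr_ge0 ?expR_ge0.
apply: (@le_lt_trans _ _
  (\int[lebesgue_measure]_t
     ((2 * expR (a * ln (2 * a)))%:E * (exponential_pdf 2^-1 t)%:E))%E).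
  rewrite [leLHS]integral_mkcond; apply: ge0_le_integral => //=.
  - by move=> t _; apply: erestrict_ge0 => x _; rewrite lee_fin.
  - by apply/(measurable_restrictT _ _).1 => //; exact: measurable_Gamma_integrand.
  - apply/measurable_EFinP/measurable_funM => //.
    exact: measurable_exponential_pdf.
  - move=> t _; rewrite patchE mem_setE in_itv/= andbT; case: ifPn => t1.
      rewrite -EFinM lee_fin exponential_pdfE; last exact/ltW/(lt_trans ltr01).
      apply: le_trans (powR_mul_expRN_le a0 (ltW t1)) _.
      rewrite le_eqVlt; apply/orP; left; apply/eqP.
      have -> : - t / 2 = - 2^-1 * t by ring.
      by field.
    by rewrite -EFinM lee_fin mulr_ge0// exponential_pdf_ge0.
rewrite ge0_integralZl_EFin//.
- by rewrite integral_exponential_pdf// mule1 ltry.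
- by move=> t _; rewrite lee_fin exponential_pdf_ge0.
- by apply/measurable_EFinP; exact: measurable_exponential_pdf.
Qed.

Lemma EFin_Gamma (R : realType) (a : R) : 0 < a ->
  ((Gamma a)%:E = \int[lebesgue_measure]_(t in `]0%R, +oo[)
     (t `^ (a - 1) * expR (- t))%:E)%E.
Proof.
move=> a0; rewrite fineK// ge0_fin_numE; first exact: Gamma_integral_lty.
by apply: integral_ge0 => t _; rewrite lee_fin mulr_ge0 ?powR_ge0 ?expR_ge0.
Qed.

Lemma Gamma1 (R : realType) : Gamma (1 : R) = 1.
Proof.
apply: EFin_inj; rewrite EFin_Gamma// -[RHS](@integral_exponential_pdf R 1)//.
rewrite integral_itv_obnd_cbnd; last exact: measurable_Gamma_integrand.
rewrite integral_mkcond; apply: eq_integral => t _.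
rewrite patchE mem_setE in_itv/= andbT; case: ifPn => t0.
  by rewrite exponential_pdfE// subrr powRr0 mulN1r.
by rewrite lt0_exponential_pdf// ltNge.
Qed.

Lemma Gamma_ge (R : realType) (m x : R) : 0 < m -> 0 < x ->
  m `^ x * (expR (- (m + 1)) / (m + 1)) <= Gamma x.
Proof.
move=> m0 x0; have m10 : 0 < m + 1 by rewrite addr_gt0.
rewrite -lee_fin EFin_Gamma//.
set c := m `^ x * _.
have -> : c%:E = (\int[lebesgue_measure]_(t in `[m, (m + 1)%R]) c%:E)%E.
  rewrite integral_cst//= lebesgue_measure_itv/= lte_fin ltrDl ltr01.
  by rewrite -EFinB addrAC subrr add0r mule1.
have h0 t : 0 <= t `^ (x - 1) * expR (- t) by rewrite mulr_ge0 ?powR_ge0 ?expR_ge0.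
apply: (@le_trans _ _ (\int[lebesgue_measure]_(t in `[m, (m + 1)%R])
    (t `^ (x - 1) * expR (- t))%:E)%E).
  apply: ge0_le_integral => //=.
  - move=> t _; rewrite lee_fin mulr_ge0 ?powR_ge0// divr_ge0 ?expR_ge0//.
    exact: ltW.
  - exact: measurable_Gamma_integrand.
  - move=> t; rewrite in_itv/= => /andP[mt tm].
    have t0 : 0 < t by rewrite (lt_le_trans m0).
    have tE : t `^ (x - 1) = t `^ x / t.
      by rewrite powRB ?(gt_eqF t0) ?implybT// powRr1// ltW.
    rewrite lee_fin /c tE -mulrA.
    apply: ler_pM; rewrite ?powR_ge0//.
    + by rewrite divr_ge0 ?expR_ge0// ltW.
    + by apply: ge0_ler_powR; rewrite ?nnegrE// ltW.
    + rewrite mulrC; apply: ler_pM; rewrite ?expR_ge0 ?invr_ge0 ?(ltW m10)//.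
        by rewrite lef_pV2 ?posrE.
      by rewrite ler_expR lerN2.
apply: ge0_subset_integral => //=.
- exact: measurable_Gamma_integrand.
- by move=> t _; rewrite lee_fin.
- by move=> t /=; rewrite !in_itv/= andbT => /andP[/(lt_le_trans m0)].
Qed.

Lemma Gamma_gt0 (R : realType) (x : R) : 0 < x -> 0 < Gamma x.
Proof.
move=> x0; apply: lt_le_trans (Gamma_ge ltr01 x0).
by rewrite mulr_gt0 ?powR_gt0// divr_gt0 ?expR_gt0.
Qed.

Lemma EFin_Gamma_pos_powR (R : realType) (a : R) : 0 < a ->
  ((Gamma a)%:E = \int[lebesgue_measure]_t (pos_powR a t * expR (- t))%:E)%E.
Proof. by move=> a0; rewrite EFin_Gamma// integral_itv0y_pos_powR. Qed.

Lemma measurable_pos_powR_expR (R : realType) (a : R) :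
  measurable_fun [set: R] (fun t => pos_powR a t * expR (- t)).
Proof.
apply: measurable_funM; first exact: measurable_pos_powR.
exact: measurableT_comp.
Qed.

(* Euler's identity [Gamma a * Gamma b = B(a, b) * Gamma (a + b)], keeping
   only the inequality that a lower bound on the Beta integral yields. *)
Lemma Gamma_mul_ge (R : realType) (a b c : R) : 0 < a -> 0 < b -> 0 <= c ->
  (forall u, 0 < u -> ((c * u `^ (a + b - 1))%:E <=
     \int[lebesgue_measure]_(t in `]0%R, u[)
       ((u - t) `^ (a - 1) * t `^ (b - 1))%:E)%E) ->
  c * Gamma (a + b) <= Gamma a * Gamma b.
Proof.
move=> a0 b0 c0 hc; have ab0 : 0 < a + b by rewrite addr_gt0.
pose T := measurableTypeR R.
pose g (x t : R) := pos_powR x t * expR (- t).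
have g0 x t : 0 <= g x t by rewrite mulr_ge0 ?pos_powR_ge0 ?expR_ge0.
have mg x : measurable_fun [set: T] (g x) by exact: measurable_pos_powR_expR.
have mgE x : measurable_fun [set: T] (fun t => (g x t)%:E).
  by apply/measurable_EFinP; exact: mg.
pose h (z : T * T) : R := g b z.1 * g a (z.2 - z.1).
have h0 z : 0 <= h z by rewrite mulr_ge0.
have mh : measurable_fun [set: T * T] h.
  apply: measurable_funM; first exact: (measurableT_comp (mg b) measurable_fst).
  apply: (measurableT_comp (mg a)).
  by apply: measurable_funB; [exact: measurable_snd|exact: measurable_fst].
rewrite -lee_fin !EFinM [leRHS]muleC.
have -> : ((Gamma b)%:E * (Gamma a)%:E =
    \int[lebesgue_measure]_t \int[lebesgue_measure]_u (h (t, u))%:E)%E.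
  rewrite [X in (X * _)%E]EFin_Gamma_pos_powR//.
  rewrite -ge0_integralZr//; last 3 first.
  - exact: (mgE b).
  - by move=> t _; rewrite lee_fin g0.
  - by rewrite lee_fin ltW// Gamma_gt0.
  apply: eq_integral => t _.
  rewrite EFin_Gamma_pos_powR// (ge0_integral_shift (- t)); last 2 first.
  - exact: (mgE a).
  - by move=> s; rewrite lee_fin g0.
  rewrite -ge0_integralZl_EFin//.
  - by move=> s _; rewrite lee_fin g0.
  - apply/measurable_EFinP; apply: (measurableT_comp (mg a)).
    by apply: measurable_funD.
  - exact: g0.
rewrite (fubini_tonelli (m1 := lebesgue_measure) (m2 := lebesgue_measure)
  (fun z : T * T => (h z)%:E)); last 2 first.
- exact/measurable_EFinP.
- by move=> z; rewrite lee_fin.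
rewrite EFin_Gamma_pos_powR// -ge0_integralZl_EFin//; last 2 first.
- by move=> t _; rewrite lee_fin g0.
- exact: (mgE (a + b)).
apply: ge0_le_integral => //=.
- by move=> u _; rewrite -EFinM lee_fin mulr_ge0// g0.
- by apply/measurable_EFinP/measurable_funM => //; exact: mg.
- apply: (measurable_fun_fubini_tonelli_G (m1 := lebesgue_measure)
    (fun z => (h z)%:E)).
  + exact/measurable_EFinP.
  + by move=> z; rewrite lee_fin.
move=> u _; rewrite /pos_powR; case: ifPn => u0; last first.
  by rewrite mul0r mule0; apply: integral_ge0 => t _; rewrite lee_fin.
rewrite -EFinM mulrA mulrC.
have mB : measurable_fun [set: T]
    (fun t : T => (u - t) `^ (a - 1) * t `^ (b - 1)).
  apply: measurable_funM; last exact: measurable_powR.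
  apply: (measurableT_comp (measurable_powR (a - 1))).
  by apply: measurable_funB.
have e0 : 0 <= expR (- u) by exact: expR_ge0.
apply: le_trans (_ : (expR (- u))%:E * \int[lebesgue_measure]_(t in `]0%R, u[)
       ((u - t) `^ (a - 1) * t `^ (b - 1))%:E <= _)%E.
  by rewrite EFinM; apply: lee_wpmul2l; [rewrite lee_fin|exact: hc].
rewrite -ge0_integralZl_EFin//; last 2 first.
- by move=> t _; rewrite lee_fin mulr_ge0 ?powR_ge0.
- by apply/measurable_EFinP/measurable_funTS; exact: mB.
rewrite [leLHS]integral_mkcond; apply: ge0_le_integral => //=.
- move=> t _; apply: erestrict_ge0 => x _.
  by rewrite -EFinM lee_fin !mulr_ge0 ?powR_ge0.
- apply/(measurable_restrictT _ _).1 => //.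
  apply/measurable_EFinP/measurable_funTS; exact: measurable_funM.
- apply/measurable_EFinP; apply: (measurableT_comp mh).
  exact: pair2_measurable.
- move=> t _; rewrite patchE mem_setE in_itv/=; case: ifPn => [/andP[t0 tu]|_].
    rewrite -EFinM lee_fin /h /g /pos_powR/= t0 subr_gt0 tu.
    rewrite le_eqVlt; apply/orP; left; apply/eqP.
    have -> : - u = - t + - (u - t) by ring.
    by rewrite expRD; ring.
  by rewrite lee_fin.
Qed.

Lemma sum_le_integral_cells (R : realType) (f : R -> R) (x c : nat -> R)
    (m : nat) :
  measurable_fun [set: R] f -> (forall t, 0 <= f t) ->
  {homo x : i j / (i <= j)%N >-> i <= j} ->
  (forall i, (i < m)%N ->
    ((c i)%:E <= \int[lebesgue_measure]_(t in `]x i, x i.+1[) (f t)%:E)%E) ->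
  ((\sum_(0 <= i < m) c i)%:E <=
    \int[lebesgue_measure]_(t in `]x 0%N, x m[) (f t)%:E)%E.
Proof.
move=> mf f0 homx; elim: m => [|m IH] hc.
  by rewrite big_geq//; apply: integral_ge0 => t _; rewrite lee_fin.
have mfE (D : set R) : measurable_fun D (EFin \o f).
  by apply/measurable_EFinP; exact: measurable_funTS.
rewrite big_nat_recr//= EFinD.
apply: le_trans (leeD (IH _) (hc m _)) _ => //.
  by move=> i im; apply: hc; rewrite ltnS ltnW.
rewrite -ge0_integral_setU//=.
- apply: ge0_subset_integral => //=; [exact: measurableU|exact: mfE| |].
    by move=> t _; rewrite lee_fin.
  move=> t [] /=; rewrite !in_itv/= => /andP[t1 t2]; rewrite ?t1 ?t2 ?andbT.
    by rewrite (lt_le_trans t2)// homx.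
  by rewrite (le_lt_trans _ t1)// homx.
- exact: mfE.
- by move=> t _; rewrite lee_fin.
- apply/eqP; rewrite -subset0 => t /= []; rewrite !in_itv/=.
  by move=> /andP[_ h] /andP[/(lt_trans h)]; rewrite ltxx.
Qed.

Lemma le_integral_cell (R : realType) (f : R -> R) (a b c : R) :
  measurable_fun [set: R] f -> a <= b -> 0 <= c ->
  (forall t, a < t < b -> c <= f t) ->
  ((c * (b - a))%:E <= \int[lebesgue_measure]_(t in `]a, b[) (f t)%:E)%E.
Proof.
move=> mf ab c0 hc.
have -> : (c * (b - a))%:E = (\int[lebesgue_measure]_(t in `]a, b[) c%:E)%E.
  rewrite integral_cst//= lebesgue_measure_itv/= lte_fin EFinM.
  case: ltP => // ba; have -> : a = b by apply/le_anti; rewrite ab ba.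
  by rewrite subrr.
apply: ge0_le_integral => //=.
- by apply/measurable_EFinP; exact: measurable_funTS.
Qed.

Lemma le_integral_cell_affine (R : realType) (f : R -> R) (p r A k : R) :
  measurable_fun [set: R] f -> 0 < r -> 0 <= A -> `|k| * r <= 1 ->
  (forall t, p - r < t < p + r -> A * (1 + k * (t - p)) <= f t) ->
  ((A * (2 * r))%:E <=
    \int[lebesgue_measure]_(t in `](p - r)%R, (p + r)%R[) (f t)%:E)%E.
Proof.
move=> mf r0 A0 kr hf.
pose F t : R := A * (t + k / 2 * (t - p) ^+ 2).
pose g t : R := A * (1 + k * (t - p)).
have dF (t : R) : is_derive t 1 F (g t).
  by apply: is_derive_eq; rewrite /g /GRing.scale/=; field.
have cg : continuous g.
  move=> t; apply: differentiable_continuous; apply/derivable1_diffP.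
  exact: ex_derive.
have cF : continuous F.
  move=> t; apply: differentiable_continuous; apply/derivable1_diffP.
  exact: ex_derive.
have prp : p - r < p + r by lra.
have <- : (\int[lebesgue_measure]_(t in `](p - r)%R, (p + r)%R[) (g t)%:E
    = (A * (2 * r))%:E)%E.
  rewrite -(@integral_itv_bndoo _ _ _ _ true false); last first.
    by apply/measurable_EFinP/measurable_funTS; exact: continuous_measurable_fun.
  rewrite (@continuous_FTC2 _ _ F)//.
  - rewrite -EFinB /F; congr (_%:E); by field.
  - exact: continuous_subspaceT.
  - split.
    + by move=> t _; exact: ex_derive.
    + by apply: cvg_at_right_filter; exact: cF.
    + by apply: cvg_at_left_filter; exact: cF.
  - by move=> t _; rewrite derive1E; exact: derive_val.
apply: ge0_le_integral => //=.
- move=> t; rewrite in_itv/= => /andP[t1 t2].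
  rewrite lee_fin mulr_ge0//.
  have tp : `|t - p| <= r by rewrite ler_norml; apply/andP; split; lra.
  have : `|k * (t - p)| <= 1.
    by rewrite normrM (le_trans _ kr)// ler_wpM2l.
  rewrite ler_norml => /andP[h _]; lra.
- by apply/measurable_EFinP/measurable_funTS; exact: continuous_measurable_fun.
- by apply/measurable_EFinP; exact: measurable_funTS.
Qed.

Lemma measurable_beta_integrand (R : realType) (a b u : R) :
  measurable_fun [set: R] (fun t => (u - t) `^ (a - 1) * t `^ (b - 1)).
Proof.
apply: measurable_funM; last exact: measurable_powR.
apply: (measurableT_comp (measurable_powR (a - 1))).
exact: measurable_funB.
Qed.

Lemma powR_ge_tangent (R : realType) (q p t : R) : q <= 0 -> 0 < p -> 0 < t ->
  p `^ q * expR (q * ((t - p) / p)) <= t `^ q.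
Proof.
move=> q0 p0 t0; rewrite /powR !gt_eqF// -expRD ler_expR.
rewrite -lerBrDl -mulrBr -ln_div ?posrE// ler_wnM2l//.
have := expR_ge1Dx (ln (t / p)); rewrite lnK ?posrE ?divr_gt0// => h.
by rewrite mulrBl divff ?gt_eqF// lerBrDl.
Qed.

Lemma le0r_powR (R : realType) (q x y : R) : q <= 0 -> 0 < x -> x <= y ->
  y `^ q <= x `^ q.
Proof.
move=> q0 x0 xy; have y0 := lt_le_trans x0 xy.
by rewrite /powR !gt_eqF// ler_expR ler_wnM2l// ler_ln.
Qed.

Lemma beta_kernel_scale (R : realType) (a b d : R) (n j : nat) :
  0 < d -> (j <= n)%N ->
  (n%:R * d - j%:R * d) `^ (a - 1) * (j%:R * d) `^ (b - 1) * d
  = (n - j)%:R `^ (a - 1) * j%:R `^ (b - 1) * d `^ (a + b - 1).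
Proof.
move=> d0 jn; rewrite -mulrBl -natrB// !powRM ?(ltW d0)//.
have -> : d `^ (a + b - 1) = d `^ (a - 1) * d `^ (b - 1) * d.
  have dn0 : d != 0 by rewrite gt_eqF.
  rewrite -[X in _ = _ * X]powRr1 ?(ltW d0)// -!powRD ?dn0 ?implybT//.
  by congr (_ `^ _); ring.
by ring.
Qed.

Lemma sum_beta_kernel_le_ge1 (R : realType) (a b : R) (n : nat) :
  0 < a <= 1 -> 1 <= b -> (0 < n)%N ->
  (\sum_(0 <= j < n) (n - j)%:R `^ (a - 1) * j%:R `^ (b - 1)) * Gamma (a + b)
  <= n%:R `^ (a + b - 1) * (Gamma a * Gamma b).
Proof.
move=> /andP[a0 a1] b1 n0; have b0 : 0 < b by rewrite (lt_le_trans ltr01).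
have nr0 : 0 < n%:R :> R by rewrite ltr0n.
have np0 : 0 < n%:R `^ (a + b - 1) :> R by rewrite powR_gt0.
rewrite -ler_pdivrMl// mulrA [_^-1 * _]mulrC.
apply: Gamma_mul_ge => //.
  by rewrite divr_ge0 ?powR_ge0//; apply: sumr_ge0 => j _; rewrite mulr_ge0 ?powR_ge0.
move=> u u0; pose d := u / n%:R.
have d0 : 0 < d by rewrite divr_gt0.
have uE : u = n%:R * d by rewrite /d mulrCA divff ?mulr1 ?gt_eqF.
have -> : (\sum_(0 <= j < n) (n - j)%:R `^ (a - 1) * j%:R `^ (b - 1)) /
    n%:R `^ (a + b - 1) * u `^ (a + b - 1) =
    \sum_(0 <= j < n) (u - j%:R * d) `^ (a - 1) * (j%:R * d) `^ (b - 1)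
      * (j.+1%:R * d - j%:R * d).
  rewrite [in LHS]uE powRM ?(ltW d0) ?(ltW nr0)// mulrA mulfVK ?gt_eqF//.
  rewrite mulr_suml !big_mkord; apply: eq_bigr => j _.
  rewrite uE -(beta_kernel_scale _ _ d0 (ltnW (ltn_ord j))).
  by rewrite -[(j.+1%:R * d - _)]mulrBl -natrB// subSnn mul1r.
pose x (j : nat) := j%:R * d.
have -> : `]0%R, u[%classic = `]x 0%N, x n[%classic by rewrite /x mul0r -uE.
apply: sum_le_integral_cells.
- exact: measurable_beta_integrand.
- by move=> t; rewrite mulr_ge0 ?powR_ge0.
- by move=> i j ij; rewrite ler_wpM2r ?(ltW d0)// ler_nat.
move=> i im; apply: le_integral_cell.
- exact: measurable_beta_integrand.
- by rewrite ler_wpM2r ?(ltW d0)// ler_nat.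
- by rewrite mulr_ge0 ?powR_ge0.
move=> t /andP[t1 t2].
have x0 : 0 <= x i by rewrite mulr_ge0 ?(ltW d0).
have tu : t < u.
  by rewrite (lt_le_trans t2)// uE ler_wpM2r ?(ltW d0)// ler_nat.
apply: ler_pM; rewrite ?powR_ge0//.
  apply: le0r_powR; rewrite ?subr_gt0 ?subr_le0// lerD2l lerN2; exact: ltW.
apply: ge0_ler_powR; rewrite ?subr_ge0 ?nnegrE//; last exact: ltW.
by rewrite (le_trans x0)// ltW.
Qed.

Lemma sum_beta_kernel_le_le1 (R : realType) (a b : R) (n : nat) :
  0 < a -> a <= b <= 1 -> (0 < n)%N ->
  (n%:R `^ (a - 1) + \sum_(1 <= j < n) (n - j)%:R `^ (a - 1) * j%:R `^ (b - 1))
    * Gamma (a + b) <= n%:R `^ (a + b - 1) * (Gamma a * Gamma b).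
Proof.
move=> a0 /andP[ab b1] n0; have b0 : 0 < b by rewrite (lt_le_trans a0).
have a1 := le_trans ab b1.
have nr0 : 0 < n%:R :> R by rewrite ltr0n.
have nr1 : 1 <= n%:R :> R by rewrite ler1n.
have np0 : 0 < n%:R `^ (a + b - 1) :> R by rewrite powR_gt0.
rewrite -ler_pdivrMl// mulrA [_^-1 * _]mulrC.
apply: Gamma_mul_ge => //.
  rewrite divr_ge0 ?powR_ge0// addr_ge0 ?powR_ge0//.
  by apply: sumr_ge0 => j _; rewrite mulr_ge0 ?powR_ge0.
move=> u u0; pose d := u / n%:R.
have d0 : 0 < d by rewrite divr_gt0.
have uE : u = n%:R * d by rewrite /d mulrCA divff ?mulr1 ?gt_eqF.
have dp0 : 0 <= d `^ (a + b - 1) by rewrite powR_ge0.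
rewrite {1}uE powRM ?(ltW d0) ?(ltW nr0)// mulrA mulfVK ?gt_eqF//.
pose f (t : R) := (u - t) `^ (a - 1) * t `^ (b - 1).
have mf : measurable_fun [set: R] f by exact: measurable_beta_integrand.
have f0 t : 0 <= f t by rewrite mulr_ge0 ?powR_ge0.
pose x (j : nat) : R :=
  if j == 0%N then 0 else if (j <= n)%N then (j%:R - 2^-1) * d else u.
pose c (j : nat) : R :=
  if (j == 0%N) || (j == n) then n%:R `^ (a - 1) / 2 * d `^ (a + b - 1)
  else (n - j)%:R `^ (a - 1) * j%:R `^ (b - 1) * d `^ (a + b - 1).
have -> : (n%:R `^ (a - 1) +
    \sum_(1 <= j < n) (n - j)%:R `^ (a - 1) * j%:R `^ (b - 1)) *
    d `^ (a + b - 1) = \sum_(0 <= j < n.+1) c j.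
  have cn : c n = n%:R `^ (a - 1) / 2 * d `^ (a + b - 1).
    by rewrite /c eqxx orbT.
  have c0 : c 0%N = n%:R `^ (a - 1) / 2 * d `^ (a + b - 1) by [].
  rewrite [RHS]big_nat_recr// [\sum_(0 <= _ < n) _]big_ltn//.
  rewrite [RHS]/= c0 cn mulrDl mulr_suml.
  rewrite (@eq_big_nat _ _ _ 1 n _ c); last first.
    by move=> j /andP[j0 jn]; rewrite /c (gtn_eqF j0) (ltn_eqF jn).
  by field.
have dE : d `^ (a + b - 1) = d `^ (a - 1) * d `^ (b - 1) * d.
  have dn0 : d != 0 by rewrite gt_eqF.
  rewrite -[X in _ = _ * X]powRr1 ?(ltW d0)// -!powRD ?dn0 ?implybT//.
  by congr (_ `^ _); ring.
have -> : `]0%R, u[%classic = `]x 0%N, x n.+1[%classic by rewrite /x/= ltnn.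
apply: sum_le_integral_cells => //.
  apply/(@nondecreasing_seqP _ R x) => j; rewrite /x/=.
  case: eqP => [->|/eqP j0].
    by case: leqP => // _; rewrite ?(ltW u0)// mulr_ge0 ?(ltW d0)//; lra.
  case: (ltnP j n) => jn.
    by rewrite ltnW// ler_pM2r// lerD2r ler_nat.
  case: (leqP j n) => // jn'; rewrite uE ler_pM2r//.
  have -> : j = n by apply/eqP; rewrite eqn_leq jn jn'.
  lra.
move=> i; rewrite ltnS => iN.
case: (posnP i) => [i0|i0].
  have -> : c i = n%:R `^ (a - 1) * d `^ (a - 1) * d `^ (b - 1) * (x 1%N - x 0%N).
    by rewrite /c i0 eqxx/= /x/= n0 dE; field.
  rewrite i0; apply: le_integral_cell => //.
  - by rewrite /x/= n0 mulr_ge0 ?(ltW d0)//; lra.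
  - by rewrite !mulr_ge0 ?powR_ge0.
  move=> t; rewrite /x/= n0 => /andP[t0 t1].
  have td : t <= d by nra.
  have tu : t < u by rewrite uE (le_lt_trans _ (_ : (1 - 2^-1) * d < _))//; nra.
  rewrite -powRM ?(ltW d0) ?(ltW nr0)// -uE; apply: ler_pM; rewrite ?powR_ge0//.
    by apply: le0r_powR; rewrite ?subr_gt0 ?subr_le0//; lra.
  by apply: le0r_powR; rewrite ?subr_le0.
have x_i : x i = i%:R * d - d / 2.
  by rewrite /x gtn_eqF// iN; field.
have [{}iN|iN'] := ltnP i n; last first.
  have -> : i = n by apply/eqP; rewrite eqn_leq iN iN'.
  have xn : x n = u - d / 2.
    by rewrite /x gtn_eqF// leqnn uE; field.
  have xn1 : x n.+1 = u by rewrite /x/= ltnn.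
  apply: (@le_trans _ _ ((d `^ (a - 1) * u `^ (b - 1)) * (x n.+1 - x n))%:E).
    rewrite lee_fin /c eqxx orbT dE xn xn1 uE (powRM _ (ler0n _ n) (ltW d0)).
    rewrite (_ : n%:R * d - (n%:R * d - d / 2) = d / 2); last by ring.
    have h : n%:R `^ (a - 1) <= n%:R `^ (b - 1) :> R.
      by apply: ler_powR => //; rewrite lerD2r.
    have e0 : 0 <= d `^ (a - 1) * d `^ (b - 1) * d / 2.
      apply: divr_ge0 => //; apply: mulr_ge0; last exact: ltW.
      by rewrite mulr_ge0 ?powR_ge0.
    apply: le_trans (le_trans _ (ler_wpM2r e0 h)) _;
      by rewrite le_eqVlt; apply/orP; left; apply/eqP; field.
  apply: le_integral_cell => //.
  - by rewrite xn xn1; lra.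
  - by rewrite mulr_ge0 ?powR_ge0.
  rewrite xn xn1 => t /andP[t1 t2].
  have du : d <= u by rewrite uE ler_peMl// ltW.
  apply: ler_pM; rewrite ?powR_ge0//; apply: le0r_powR; lra.
have x_i1 : x i.+1 = i%:R * d + d / 2.
  by rewrite /x/= iN -natr1; field.
have ir : 1 <= i%:R :> R by rewrite ler1n.
have ni1 : i%:R + 1 <= n%:R :> R by rewrite natr1 ler_nat.
pose p := i%:R * d.
have p0 : 0 < p by rewrite mulr_gt0// (lt_le_trans ltr01).
have dp : d <= p by rewrite ler_peMl// ltW.
have dup : d <= u - p by rewrite uE /p; nra.
pose k := (1 - a) / (u - p) - (1 - b) / p.
have -> : c i = (u - p) `^ (a - 1) * p `^ (b - 1) * (2 * (d / 2)).
  rewrite /c gtn_eqF// ltn_eqF//= -beta_kernel_scale//; last exact: ltnW.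
  by rewrite -uE (_ : 2 * (d / 2) = d)//; field.
rewrite x_i x_i1; apply: le_integral_cell_affine => //.
- by rewrite divr_gt0.
- by rewrite mulr_ge0 ?powR_ge0.
- have frac (q r : R) : 0 <= q <= 1 -> 0 < r -> d <= r -> 0 <= q / r * d <= 1.
    move=> /andP[q0 q1] r0 dr.
    have e0 : 0 <= d / r by rewrite divr_ge0// ltW.
    have e1 : d / r <= 1 by rewrite ler_pdivrMr// mul1r.
    by rewrite mulrAC -mulrA mulr_ge0//= mulr_ile1.
  have h1 : 0 <= (1 - a) / (u - p) * d <= 1 by apply: frac => //; lra.
  have h2 : 0 <= (1 - b) / p * d <= 1 by apply: frac => //; lra.
  have kd : k * d = (1 - a) / (u - p) * d - (1 - b) / p * d by rewrite mulrBl.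
  have : `|k * d| <= 1 by rewrite ler_norml kd; lra.
  by rewrite normrM (gtr0_norm d0); lra.
move=> t /andP[t1 t2].
have t0 : 0 < t by rewrite /p in dp; lra.
have ut0 : 0 < u - t by rewrite /p in dup; lra.
have up0 : 0 < u - p by lra.
have ha : a - 1 <= 0 by lra.
have hb : b - 1 <= 0 by lra.
apply: le_trans (ler_pM _ _ (powR_ge_tangent ha up0 ut0)
  (powR_ge_tangent hb p0 t0)); rewrite ?mulr_ge0 ?powR_ge0 ?expR_ge0//.
rewrite mulrACA -expRD ler_wpM2l ?mulr_ge0 ?powR_ge0//.
apply: le_trans (expR_ge1Dx _).
rewrite le_eqVlt; apply/orP; left; apply/eqP; rewrite /k -/p.
by field; rewrite !gt_eqF.
Qed.

Definition conv (R : realType) (f g : nat -> R) (n : nat) : R :=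
  \sum_(k < n.+1) f k * g (n - k)%N.

Lemma coefM_conv (R : realType) (f g : nat -> R) (N n : nat) : (n <= N)%N ->
  ((\poly_(i < N.+1) f i) * (\poly_(i < N.+1) g i))`_n = conv f g n.
Proof.
move=> nN; rewrite coefM; apply: eq_bigr => k _.
rewrite !coef_poly !ifT//; rewrite ltnS (leq_trans _ nN)//.
  exact: leq_subr.
by rewrite -ltnS.
Qed.

Lemma convC (R : realType) (f g : nat -> R) : conv f g =1 conv g f.
Proof. by move=> n; rewrite -!(@coefM_conv _ _ _ n)// mulrC. Qed.

Lemma convA (R : realType) (f g h : nat -> R) :
  conv f (conv g h) =1 conv (conv f g) h.
Proof.
move=> n; pose p (u : nat -> R) := \poly_(i < n.+1) u i.
transitivity ((p f * (p g * p h))`_n).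
  rewrite coefM; apply: eq_bigr => k _.
  by rewrite coef_poly ltn_ord coefM_conv// leq_subr.
rewrite mulrA coefM; apply: eq_bigr => k _.
by rewrite coef_poly ltnS leq_subr coefM_conv// -ltnS.
Qed.

Lemma conv_inverse_exists (R : realType) (b : nat -> R) : b 0%N = 1 ->
  exists2 d : nat -> R, d 0%N = 1 & forall n, conv d b n.+1 = 0.
Proof.
move=> b0.
pose step (n : nat) (D : nat -> R) (k : nat) : R :=
  if k == n.+1 then - \sum_(i < n.+1) D i * b (n.+1 - i)%N else D k.
pose D := fix D n := if n is m.+1 then step m (D m) else fun=> 1 : R.
have DE n k : (k <= n)%N -> D n k = D k k.
  elim: n => [|n IH]; first by rewrite leqn0 => /eqP ->.
  by rewrite leq_eqVlt => /predU1P[-> //|kn]; rewrite /= /step ltn_eqF// IH.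
have DS n : D n.+1 n.+1 = - \sum_(i < n.+1) D n i * b (n.+1 - i)%N.
  by rewrite /= /step eqxx.
exists (fun n => D n n) => // n.
rewrite /conv big_ord_recr subnn b0 mulr1 DS.
apply/eqP; rewrite addr_eq0 opprK; apply/eqP; apply: eq_bigr => k _.
by rewrite (DE n)// -ltnS.
Qed.

Lemma logconvex_ratio (R : realType) (b : nat -> R) :
  (forall k, 0 < b k) ->
  (forall k, b k.+1 ^+ 2 <= b k * b k.+2) ->
  forall i j, (i <= j)%N -> b i.+1 * b j <= b i * b j.+1.
Proof.
move=> b0 bc i; elim=> [|j IH]; first by rewrite leqn0 => /eqP ->; rewrite mulrC.
rewrite leq_eqVlt => /predU1P[->|]; first by rewrite mulrC.
rewrite ltnS => /IH {}IH; rewrite -(ler_pM2r (b0 j)).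
have : b i.+1 * b j * b j.+1 <= b i * b j.+1 * b j.+1 by rewrite ler_pM2r.
have : b i * b j.+1 ^+ 2 <= b i * (b j * b j.+2) by rewrite ler_pM2l.
lra.
Qed.

(* Kaluza's theorem: the reciprocal of a power series with log-convex
   coefficients and constant term 1 has nonpositive higher coefficients. *)
Lemma kaluza (R : realType) (b d : nat -> R) :
  b 0%N = 1 -> (forall k, 0 < b k) ->
  (forall k, b k.+1 ^+ 2 <= b k * b k.+2) ->
  d 0%N = 1 -> (forall n, conv d b n.+1 = 0) ->
  forall n, d n.+1 <= 0.
Proof.
move=> b0 bp bc d0 db.
have bE n : b n.+1 = - \sum_(k < n.+1) d k.+1 * b (n - k)%N.
  by have /eqP := db n; rewrite /conv big_ord_recl/= d0 mul1r subn0 addr_eq0 => /eqP.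
elim/ltn_ind => -[|n] IH.
  by have := bE 0%N; rewrite big_ord1 subn0 b0 mulr1; have := bp 1%N; lra.
have := bE n.+1; rewrite big_ord_recr/= subnn b0 mulr1 => bn.
have : b n.+2 * b n.+1 = b n.+2 * - \sum_(k < n.+1) d k.+1 * b (n - k)%N.
  by congr (_ * _); exact: bE.
have : \sum_(k < n.+1) d k.+1 * b (n.+1 - k)%N * b n.+1 >=
       \sum_(k < n.+1) d k.+1 * b (n - k)%N * b n.+2.
  apply: ler_sum => k _; rewrite -!mulrA ler_wnM2l ?IH//.
  rewrite subSn -1?ltnS//; apply: logconvex_ratio => //.
  by rewrite (leq_trans (leq_subr _ _)).
rewrite -!mulr_suml => h e.
have := congr1 ( *%R^~ (b n.+1)) bn => /= e2.
rewrite -(pmulr_lle0 _ (bp n.+1)); lra.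
Qed.

Lemma L1_weight0 (R : realType) (a : R) : a < 1 -> L1_weight a 0 = 1.
Proof.
by move=> a1; rewrite /L1_weight powR1 powR0 ?subr0// subr_eq0 gt_eqF.
Qed.

Lemma L1_weight_gt0 (R : realType) (a : R) (k : nat) : a < 1 -> 0 < L1_weight a k.
Proof.
move=> a1; rewrite subr_gt0; apply: gt0_ltr_powR; rewrite ?nnegrE ?subr_gt0//.
by rewrite ltr_nat.
Qed.

Lemma sum_L1_weight (R : realType) (a : R) (n : nat) : a < 1 ->
  \sum_(k < n) L1_weight a k = n%:R `^ (1 - a).
Proof.
move=> a1; rewrite -(big_mkord xpredT (L1_weight a)) telescope_sumr//.
by rewrite powR0 ?subr0// subr_eq0 gt_eqF.
Qed.

Lemma L1_weight_ratio (R : realType) (a : R) (k : nat) : 0 < a < 1 ->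
  exists2 x : R, k%:R < x < k.+1%:R &
    L1_weight a k.+1 = L1_weight a k * ((x + 1) / x) `^ (- a).
Proof.
move=> /andP[a0 a1]; have s0 : 0 < 1 - a by lra.
have k1 : k%:R < k.+1%:R :> R by rewrite ltr_nat.
have kx (x : R) : x \in `]k%:R, k.+1%:R[ -> 0 < x.
  by rewrite in_itv/= => /andP[+ _]; apply: le_lt_trans; exact: ler0n.
have cg : {within `[0, +oo[, continuous (@powR R ^~ (1 - a))}%classic.
  apply/continuous_within_itvcyP; split.
    move=> y; rewrite in_itv/= andbT => y0.
    apply: differentiable_continuous; apply/derivable1_diffP.
    by apply: derivable_powR; rewrite in_itv/= andbT.
  by rewrite powR0 ?gt_eqF//; exact: powR_cvg0.
have df (x : R) : 0 < x + 1 ->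
    is_derive x 1 (fun x => (x + 1) `^ (1 - a)) ((1 - a) * (x + 1) `^ (1 - a - 1)).
  move=> x10; rewrite -[X in is_derive _ _ _ X]mulr1.
  exact: (@is_derive1_comp _ (@powR R ^~ (1 - a)) (shift 1) x _ _
    (is_derive1_powR _ x10) (is_derive_shift _ _ _)).
have [|||||x xk /= e] := @cauchy_MVT R (fun x => (x + 1) `^ (1 - a))
  (fun x => (1 - a) * (x + 1) `^ (1 - a - 1))
  (fun x => x `^ (1 - a)) (fun x => (1 - a) * x `^ (1 - a - 1)) k%:R k.+1%:R k1.
- apply: derivable_within_continuous => x; rewrite in_itv/= => /andP[kx' _].
  have x10 : 0 < x + 1 by have := ler0n R k; lra.
  exact: (@ex_derive _ _ _ _ _ _ _ (df _ x10)).
- apply: continuous_subspaceW cg => x /=; rewrite !in_itv/= andbT => /andP[+ _].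
  by apply: le_trans; exact: ler0n.
- by move=> x /kx x0; apply: df; lra.
- by move=> x /kx x0; exact: is_derive1_powR.
- by move=> x /kx x0; rewrite mulf_neq0 ?gt_eqF// powR_gt0.
have x0 := kx _ xk.
rewrite in_itv/= in xk; exists x => //.
have bk := L1_weight_gt0 k a1.
move: e; have -> : 1 - a - 1 = - a by ring.
have xE : (x + 1) `^ (- a) = ((x + 1) / x) `^ (- a) * x `^ (- a).
  by rewrite -powRM ?mulfVK ?gt_eqF ?divr_ge0//; lra.
rewrite !natr1 -/(L1_weight a k) -/(L1_weight a k.+1) => e.
have -> : L1_weight a k.+1 = L1_weight a k.+1 / L1_weight a k * L1_weight a k.
  by rewrite mulfVK// gt_eqF.
rewrite -e xE [RHS]mulrC; congr (_ * _); field.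
by rewrite !gt_eqF ?powR_gt0.
Qed.

Lemma L1_weight_le (R : realType) (a : R) (k : nat) : 0 < a < 1 ->
  L1_weight a k.+1 <= L1_weight a k.
Proof.
move=> a01; have [x /andP[kx _] ->] := L1_weight_ratio k a01.
move: a01 => /andP[a0 a1]; have x0 := le_lt_trans (ler0n _ _) kx.
rewrite ler_piMr ?(ltW (L1_weight_gt0 _ a1))// -[leRHS](powRr0 ((x + 1) / x)).
by apply: ler_powR; [rewrite ler_pdivlMr// mul1r; lra|lra].
Qed.

Lemma L1_weight_logconvex (R : realType) (a : R) (k : nat) : 0 < a < 1 ->
  L1_weight a k.+1 ^+ 2 <= L1_weight a k * L1_weight a k.+2.
Proof.
move=> a01; have [x /andP[kx xk] ex] := L1_weight_ratio k a01.
have [z /andP[kz zk] ->] := L1_weight_ratio k.+1 a01.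
move: a01 => /andP[a0 a1]; have x0 := le_lt_trans (ler0n _ _) kx.
have z0 := le_lt_trans (ler0n _ _) kz.
have b0 := L1_weight_gt0 k a1; have b1 := L1_weight_gt0 k.+1 a1.
rewrite expr2 {1}ex mulrAC -mulrA ler_pM2l// ler_pM2l//.
apply: le0r_powR; first by rewrite oppr_le0 ltW.
  by rewrite divr_gt0// addr_gt0.
rewrite ler_pdivrMr// mulrAC ler_pdivlMr//; nra.
Qed.

Lemma L1_inverse_kernel (R : realType) (a : R) : 0 < a < 1 ->
  exists P : nat -> R,
    [/\ P 0%N = 1, forall n, 0 <= P n <= n.+1%:R `^ (a - 1),
        forall n, conv P (L1_weight a) n = 1
      & forall y n, y n = conv P (fun m => y m - \sum_(0 <= k < m)
          (L1_weight a (m - k - 1) - L1_weight a (m - k)) * y k) n].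
Proof.
move=> a01; have /andP[a0 a1] := a01; pose b := L1_weight a.
have b0 : b 0%N = 1 by exact: L1_weight0.
have bp k : 0 < b k by exact: L1_weight_gt0.
have [d d0 db] := conv_inverse_exists b0.
have dle0 : forall n, d n.+1 <= 0.
  by apply: (kaluza b0 bp) => // k; exact: L1_weight_logconvex.
pose P n := \sum_(k < n.+1) d k.
have PS n : P n.+1 = P n + d n.+1 by rewrite /P big_ord_recr.
have P0 : P 0%N = 1 by rewrite /P big_ord1.
have Pb n : conv P b n = 1.
  elim: n => [|n IH]; first by rewrite /conv big_ord1 P0 b0 mulr1.
  rewrite -IH /conv big_ord_recl/= P0.
  under eq_bigr do rewrite /bump/= add1n PS mulrDl subSS.
  rewrite big_split/= addrCA -[RHS]addr0; congr (_ + _).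
  have := db n; rewrite /conv big_ord_recl/= d0.
  by under eq_bigr do rewrite /bump/= add1n subSS.
have Pnonincr i j : (i <= j)%N -> P j <= P i.
  by apply: (@nonincreasing_seqP _ R P).1 => n; rewrite PS gerDl.
have Pge0 n : 0 <= P n.
  elim/ltn_ind: n => -[|n] IH; first by rewrite P0.
  have := Pb n.+1; rewrite /conv big_ord_recr/= subnn b0 mulr1.
  have : \sum_(k < n.+1) P k * b (n.+1 - k)%N <= conv P b n.
    apply: ler_sum => k _; rewrite ler_wpM2l ?IH// subSn -1?ltnS//.
    exact: L1_weight_le.
  by rewrite Pb; lra.
exists P; split=> // [n|y n].
  rewrite Pge0/=.
  have n0 : 0 < n.+1%:R `^ (1 - a) :> R by rewrite powR_gt0.
  have -> : n.+1%:R `^ (a - 1) = (n.+1%:R `^ (1 - a))^-1 :> R.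
    by rewrite -powRN opprB.
  rewrite -[leRHS]mul1r ler_pdivlMr// -sum_L1_weight// -(Pb n) convC.
  rewrite mulr_sumr; apply: ler_sum => k _.
  by rewrite mulrC ler_wpM2l ?(ltW (bp k))// Pnonincr// leq_subr.
pose c m : R := if m is m'.+1 then b m - b m' else 1.
have cy m : y m - \sum_(0 <= k < m) (b (m - k - 1)%N - b (m - k)%N) * y k
    = conv y c m.
  rewrite /conv big_ord_recr/= subnn mulr1 addrC -sumrN big_mkord; congr (_ + _).
  apply: eq_bigr => k _; rewrite -mulNr opprB mulrC.
  have := ltn_ord k; rewrite -subn_gt0; case: (m - k)%N => // q _.
  by rewrite subn1.
have Pc m : conv P c m = (m == 0%N)%:R.
  case: m => [|m]; first by rewrite /conv big_ord1 P0 mulr1.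
  have := Pb m.+1; rewrite -(Pb m) /conv big_ord_recr/= subnn b0 mulr1 => e.
  rewrite /conv big_ord_recr/= subnn mulr1.
  under eq_bigr => k _ do rewrite subSn -1?ltnS//= mulrBr.
  rewrite sumrB (eq_bigr (fun k : 'I__ => P k * b (m.+1 - k)%N)).
    by rewrite addrAC e subrr.
  by move=> k _; rewrite subSn// -ltnS.
have -> : (fun m => y m - \sum_(0 <= k < m)
    (L1_weight a (m - k - 1) - L1_weight a (m - k)) * y k) = conv c y.
  by apply/funext => m; rewrite cy convC.
rewrite convA {1}/conv big_ord_recl Pc mul1r subn0 big1 ?addr0// => k _.
by rewrite Pc mul0r.
Qed.

Lemma L1_inverse_bound (R : realType) (a : R) (P y g : nat -> R) (n : nat) (r : R) :
  (forall m, 0 <= P m) ->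
  y n = conv P (fun m => y m - \sum_(0 <= k < m)
          (L1_weight a (m - k - 1) - L1_weight a (m - k)) * y k) n ->
  (forall m, (1 <= m <= n)%N -> y m - \sum_(0 <= k < m)
     (L1_weight a (m - k - 1) - L1_weight a (m - k)) * y k
     <= L1_weight a m * r + g m) ->
  y n <= P n * y 0%N + r * \sum_(k < n) P k * L1_weight a (n - k)%N
         + \sum_(k < n) P k * g (n - k)%N.
Proof.
move=> P0 yE yg; rewrite yE /conv big_ord_recr/= subnn big_geq// subr0.
rewrite addrC -addrA lerD2l mulr_sumr -big_split/=; apply: ler_sum => k _.
rewrite (mulrC r) -mulrA -mulrDr ler_wpM2l// yg// leq_subr andbT.
by rewrite subn_gt0.
Qed.

(* Moving the [k = 0] term [lambda0 * y n] to the left leaves the spare term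
   [lambda0 * n `^ (a - 1) * y 0], which is what keeps the constant in front of
   [y 0] equal to 1 in the Riemann-Liouville case. *)
Lemma L1_absorb (R : realType) (a c l0 l1 G : R) (P y F : nat -> R) (n : nat) :
  a <= 1 -> 0 <= c -> 0 <= l0 -> 0 <= l1 -> (0 < n)%N ->
  P 0%N = 1 -> (forall m, 0 <= P m <= m.+1%:R `^ (a - 1)) ->
  (forall m, (m <= n)%N -> 0 <= y m) -> (forall m, (m <= n)%N -> 0 <= F m) ->
  c * \sum_(0 <= k < n) (n - k)%:R `^ (a - 1) * F k.+1 <= G ->
  \sum_(k < n) P k * (c * (l0 * y (n - k)%N + l1 * y (n - k - 1)%N + F (n - k)%N))
  <= c * l0 * y n - c * l0 * (n%:R `^ (a - 1) * y 0%N)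
     + 2 * (c * Num.max l0 l1 *
         \sum_(0 <= k < n) (n - k)%:R `^ (a - 1) * y k) + G.
Proof.
move=> a1 c0 l00 l10 n0 P0 Pb y0 F0 hG.
set S := \sum_(0 <= k < n) _ * y k.
have S0 : 0 <= S.
  rewrite /S big_mkord; apply: sumr_ge0 => k _.
  by rewrite mulr_ge0 ?powR_ge0// y0// ltnW.
have hF : \sum_(k < n) P k * F (n - k)%N <=
    \sum_(0 <= k < n) (n - k)%:R `^ (a - 1) * F k.+1.
  rewrite big_nat_rev/= add0n big_mkord; apply: ler_sum => k _.
  rewrite subKn ?ltn_ord// -subSn ?ltn_ord// subSS.
  by rewrite ler_wpM2r ?F0 ?leq_subr//; have /andP[] := Pb k.
have h1 : \sum_(k < n) P k * y (n - k - 1)%N <= S.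
  rewrite /S big_nat_rev/= add0n big_mkord; apply: ler_sum => k _.
  rewrite subKn ?ltn_ord// -subnDA addn1.
  by rewrite ler_wpM2r ?y0 ?leq_subr//; have /andP[] := Pb k.
have h0 : \sum_(k < n) P k * y (n - k)%N <= y n + (S - n%:R `^ (a - 1) * y 0%N).
  rewrite /S big_ltn// subn0 [_ + _ - _]addrC addKr.
  rewrite -(big_mkord xpredT (fun k => P k * y (n - k)%N)) big_ltn// P0 mul1r subn0.
  rewrite lerD2l [leRHS]big_nat_rev/= big_nat_cond [leRHS]big_nat_cond.
  apply: ler_sum => k /andP[/andP[k0 kn] _].
  have -> : (1 + n - k.+1 = n - k)%N by rewrite add1n subSS.
  rewrite subKn ?(ltnW kn)// ler_wpM2r ?y0 ?leq_subr//.
  have /andP[_ /le_trans] := Pb k; apply.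
  by apply: le0r_powR; rewrite ?subr_le0 ?ltr0n ?ler_nat.
have -> : \sum_(k < n) P k * (c * (l0 * y (n - k)%N + l1 * y (n - k - 1)%N + F (n - k)%N))
    = c * l0 * \sum_(k < n) P k * y (n - k)%N
      + c * l1 * \sum_(k < n) P k * y (n - k - 1)%N
      + c * \sum_(k < n) P k * F (n - k)%N.
  by rewrite !mulr_sumr -!big_split/=; apply: eq_bigr => k _; ring.
have cl0 : 0 <= c * l0 by rewrite mulr_ge0.
have cl1 : 0 <= c * l1 by rewrite mulr_ge0.
have m0 : c * l0 * S <= c * Num.max l0 l1 * S.
  by rewrite ler_wpM2r// ler_wpM2l// le_max lexx.
have m1 : c * l1 * S <= c * Num.max l0 l1 * S.
  by rewrite ler_wpM2r// ler_wpM2l// le_max lexx orbT.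
have := ler_wpM2l cl0 h0; have := ler_wpM2l cl1 h1; have := ler_wpM2l c0 hF.
rewrite !mulrDr !mulrN; lra.
Qed.

Lemma is_cvg_mittag_leffler (R : realType) (a b z : R) :
  0 < a -> 0 < b -> 0 <= z ->
  cvgn (series (fun k : nat => z ^+ k / Gamma (a * k%:R + b))).
Proof.
move=> a0 b0 z0; have z1 : 0 < 2 * z + 1 by lra.
pose m := (2 * z + 1) `^ a^-1.
have m0 : 0 < m by rewrite powR_gt0.
have mE : m `^ a = 2 * z + 1.
  by rewrite /m -powRrM mulVf ?gt_eqF// powRr1// ltW.
have ma k : m `^ (a * k%:R + b) = (2 * z + 1) ^+ k * m `^ b.
  rewrite powRD ?(gt_eqF m0) ?implybT// powRrM mE.
  by rewrite powR_mulrn// ltW.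
have ab k : 0 < a * k%:R + b by rewrite ltr_wpDl// mulr_ge0// ltW.
pose e := expR (- (m + 1)) / (m + 1).
have e0 : 0 < e by rewrite divr_gt0 ?expR_gt0// addr_gt0.
apply: (@series_le_cvg _ _ (geometric (m `^ b * e)^-1 (z / (2 * z + 1)))).
- by move=> k; rewrite divr_ge0 ?exprn_ge0// ltW// Gamma_gt0.
- move=> k; rewrite /geometric/= mulr_ge0//.
    by rewrite invr_ge0 mulr_ge0 ?powR_ge0// ltW.
  by rewrite exprn_ge0// divr_ge0// ltW.
- move=> k; rewrite /geometric/=.
  have -> : (m `^ b * e)^-1 * (z / (2 * z + 1)) ^+ k
      = z ^+ k / (m `^ (a * k%:R + b) * e).
    rewrite ma expr_div_n; field.
    by rewrite !gt_eqF ?powR_gt0 ?exprn_gt0.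
  rewrite ler_wpM2l ?exprn_ge0// lef_pV2 ?posrE ?Gamma_gt0//; last first.
    by rewrite mulr_gt0// powR_gt0.
  exact: Gamma_ge.
- apply: is_cvg_geometric_series; rewrite ger0_norm ?divr_ge0 ?(ltW z1)//.
  by rewrite ltr_pdivrMr// mul1r; lra.
Qed.

Lemma mittag_leffler_ge_sum (R : realType) (a b z : R) (K : nat) :
  0 < a -> 0 < b -> 0 <= z ->
  \sum_(k < K) z ^+ k / Gamma (a * k%:R + b) <= mittag_leffler a b z.
Proof.
move=> a0 b0 z0; rewrite -(big_mkord xpredT (fun k => z ^+ k / Gamma (a * k%:R + b))).
apply: (nondecreasing_cvgn_le _ (is_cvg_mittag_leffler a0 b0 z0)).
apply/nondecreasing_seqP => n; rewrite !seriesEnat/= big_nat_recr//= lerDl.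
rewrite divr_ge0 ?exprn_ge0// ltW// Gamma_gt0// ltr_wpDl// mulr_ge0//.
exact: ltW.
Qed.

(* Iterating the inequality [K] times leaves no remainder at the indices
   [n < K], because the kernel is strictly lower triangular. *)
Lemma volterra_gronwall (R : realType) (N : nat) (L e : nat -> nat -> R)
    (y : nat -> R) :
  (forall n j, 0 <= L n j) ->
  (forall k n, \sum_(0 <= j < n) L n j * e k j <= e k.+1 n) ->
  (forall n, (n <= N)%N -> y n <= e 0%N n + \sum_(0 <= j < n) L n j * y j) ->
  forall K n, (n < K)%N -> (n <= N)%N -> y n <= \sum_(k < K) e k n.
Proof.
move=> L0 Le hy; elim=> // K IH n; rewrite ltnS => nK nN.
apply: le_trans (hy _ nN) _; rewrite big_ord_recl lerD2l.
apply: (@le_trans _ _ (\sum_(0 <= j < n) \sum_(k < K) L n j * e k j)).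
  rewrite !big_mkord; apply: ler_sum => j _; rewrite -mulr_sumr ler_wpM2l//.
  by apply: IH; [exact: leq_trans nK|exact: leq_trans (ltnW _) nN].
by rewrite exchange_big/=; apply: ler_sum => k _; exact: Le.
Qed.

Lemma powR_nat_mul (R : realType) (a : R) (j k : nat) :
  j%:R `^ (a * k%:R) = (j%:R `^ a) ^+ k :> R.
Proof. by rewrite powRrM powR_mulrn// powR_ge0. Qed.

Definition grid_shape (R : realType) (a : R) (n : nat) : R :=
  if n == 0%N then 1 else n%:R `^ (a - 1).

Lemma sum_kernel_powR_le (R : realType) (a : R) (n k : nat) : 0 < a < 1 ->
  (\sum_(0 <= j < n) (n - j)%:R `^ (a - 1) * (j%:R `^ a) ^+ k)
     * Gamma (a * k.+1%:R + 1)
  <= (n%:R `^ a) ^+ k.+1 * (Gamma a * Gamma (a * k%:R + 1)).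
Proof.
move=> /andP[a0 a1]; have ak : 0 <= a * k%:R by rewrite mulr_ge0// ltW.
case: n => [|n].
  rewrite big_geq// mul0r powR0 ?gt_eqF// expr0n mul0r//.
have := @sum_beta_kernel_le_ge1 R a (a * k%:R + 1) n.+1.
rewrite a0 (ltW a1) lerDr ak => /(_ isT isT isT).
have -> : a + (a * k%:R + 1) - 1 = a * k.+1%:R by rewrite -natr1; ring.
have -> : a + (a * k%:R + 1) = a * k.+1%:R + 1 by rewrite -natr1; ring.
rewrite powR_nat_mul; under eq_bigr do rewrite addrK powR_nat_mul.
by [].
Qed.

Lemma sum_kernel_shape_le (R : realType) (a : R) (n k : nat) :
  0 < a < 1 ->
  (\sum_(0 <= j < n) (n - j)%:R `^ (a - 1) * ((j%:R `^ a) ^+ k * grid_shape a j))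
     * Gamma (a * k.+1%:R + a)
  <= (n%:R `^ a) ^+ k.+1 * grid_shape a n * (Gamma a * Gamma (a * k%:R + a)).
Proof.
move=> /andP[a0 a1]; have ak : 0 <= a * k%:R by rewrite mulr_ge0// ltW.
case: n => [|n].
  by rewrite big_geq// mul0r powR0 ?gt_eqF// expr0n !mul0r.
have G0 (c : R) : 0 <= c -> 0 <= Gamma (c + a).
  by move=> c0; rewrite ltW// Gamma_gt0// ltr_wpDl.
have shapeE j : (0 < j)%N ->
    (j%:R `^ a) ^+ k * grid_shape a j = j%:R `^ (a * k%:R + a - 1) :> R.
  move=> j0; rewrite /grid_shape gtn_eqF// -powR_nat_mul -powRD.
    by rewrite addrA.
  by rewrite pnatr_eq0 gtn_eqF// implybT.
have bE : a + (a * k%:R + a) = a * k.+1%:R + a by rewrite -natr1; ring.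
have rhsE : (n.+1%:R `^ a) ^+ k.+1 * grid_shape a n.+1
    = n.+1%:R `^ (a + (a * k%:R + a) - 1).
  rewrite /grid_shape/= -powR_nat_mul -powRD ?pnatr_eq0 ?implybT//.
  by congr (_ `^ _); rewrite -natr1; ring.
rewrite rhsE -bE; have [b1|b1] := leP (a * k%:R + a) 1.
  have b2 : a <= a * k%:R + a <= 1 by rewrite b1 lerDr ak.
  apply: le_trans (sum_beta_kernel_le_le1 a0 b2 (ltn0Sn n)).
  rewrite ler_wpM2r//; first by rewrite bE G0// mulr_ge0// ltW.
  rewrite big_ltn// subn0 big_nat_cond [X in _ <= _ + X]big_nat_cond.
  rewrite lerD//.
    rewrite ler_piMr ?powR_ge0// /grid_shape eqxx mulr1 powR0 ?gt_eqF//.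
    by rewrite expr0n; case: (k == 0%N).
  by apply: ler_sum => j /andP[/andP[j0 _] _]; rewrite shapeE.
apply: le_trans (sum_beta_kernel_le_ge1 _ (ltW b1) (ltn0Sn n)); last first.
  by rewrite a0 ltW.
rewrite ler_wpM2r//; first by rewrite bE G0// mulr_ge0// ltW.
rewrite !big_mkord; apply: ler_sum => -[[|j] jn] _ /=; last by rewrite shapeE.
have k0 : k != 0%N by apply: contraTneq b1 => ->; rewrite mulr0 add0r -leNgt ltW.
rewrite powR0 ?gt_eqF// expr0n (negbTE k0) mul0r mulr0.
by rewrite mulr_ge0 ?powR_ge0.
Qed.

Lemma mittag_leffler_gronwall (R : realType) (a w A B : R) (N : nat)
    (y : nat -> R) :
  0 < a < 1 -> 0 <= w -> 0 <= A -> 0 <= B ->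
  (forall n, (n <= N)%N -> y n <= A + B * grid_shape a n +
     w / Gamma a * \sum_(0 <= j < n) (n - j)%:R `^ (a - 1) * y j) ->
  forall n, (n <= N)%N ->
    y n <= A * mittag_leffler a 1 (w * n%:R `^ a) +
           B * (Gamma a * mittag_leffler a a (w * n%:R `^ a) * grid_shape a n).
Proof.
move=> a01 w0 A0 B0 hy n nN; have /andP[a0 a1] := a01.
have Ga := Gamma_gt0 a0.
have s0 j : 0 <= grid_shape a j by rewrite /grid_shape; case: ifP => // _; exact: powR_ge0.
have ak b k : 0 < b -> 0 < a * k%:R + b.
  by move=> b0; rewrite ltr_wpDl// mulr_ge0// ltW.
pose u k j := (w * j%:R `^ a) ^+ k / Gamma (a * k%:R + 1).
pose v k j := (w * j%:R `^ a) ^+ k / Gamma (a * k%:R + a) * grid_shape a j.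
pose e k j := A * u k j + B * (Gamma a * v k j).
pose L n j : R := w / Gamma a * (n - j)%:R `^ (a - 1).
have L0 m j : 0 <= L m j by rewrite mulr_ge0 ?powR_ge0// divr_ge0// ltW.
have Lu k m : \sum_(0 <= j < m) L m j * u k j <= u k.+1 m.
  rewrite /u ler_pdivlMr ?Gamma_gt0 ?ak//.
  have := sum_kernel_powR_le m k a01.
  rewrite -ler_pdivrMr; last by rewrite mulr_gt0 ?Gamma_gt0 ?ak.
  have wk : 0 <= w ^+ k.+1 by rewrite exprn_ge0.
  move=> /(ler_wpM2l wk); rewrite exprMn => /(le_trans _); apply.
  rewrite le_eqVlt; apply/orP; left; apply/eqP.
  rewrite !mulr_suml mulr_sumr; apply: eq_bigr => j _; rewrite /L exprMn exprS.
  have g0 := Gamma_gt0 (ak 1 k ltr01).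
  have g1 := Gamma_gt0 (ak 1 k.+1 ltr01).
  move: (Gamma a) (Gamma _) (Gamma _) Ga g0 g1 => x1 x2 x3 x10 x20 x30.
  by field; rewrite !gt_eqF.
have Lv k m : \sum_(0 <= j < m) L m j * v k j <= v k.+1 m.
  rewrite /v mulrAC ler_pdivlMr ?Gamma_gt0 ?ak//.
  have := sum_kernel_shape_le m k a01.
  rewrite -ler_pdivrMr; last by rewrite mulr_gt0 ?Gamma_gt0 ?ak.
  have wk : 0 <= w ^+ k.+1 by rewrite exprn_ge0.
  move=> /(ler_wpM2l wk); rewrite exprMn -mulrA => /(le_trans _); apply.
  rewrite le_eqVlt; apply/orP; left; apply/eqP.
  rewrite !mulr_suml mulr_sumr; apply: eq_bigr => j _; rewrite /L exprMn exprS.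
  have g0 := Gamma_gt0 (ak a k a0).
  have g1 := Gamma_gt0 (ak a k.+1 a0).
  move: (Gamma a) (Gamma _) (Gamma _) Ga g0 g1 => x1 x2 x3 x10 x20 x30.
  by field; rewrite !gt_eqF.
have Le k m : \sum_(0 <= j < m) L m j * e k j <= e k.+1 m.
  have -> : \sum_(0 <= j < m) L m j * e k j =
      A * \sum_(0 <= j < m) L m j * u k j +
      B * (Gamma a * \sum_(0 <= j < m) L m j * v k j).
    by rewrite !mulr_sumr -big_split/=; apply: eq_bigr => j _; rewrite /e; ring.
  apply: lerD; apply: ler_wpM2l => //.
  by apply: ler_wpM2l => //; exact: ltW.
have ye m : (m <= N)%N -> y m <= e 0%N m + \sum_(0 <= j < m) L m j * y j.
  have u0 : u 0%N m = 1 by rewrite /u expr0 mulr0 add0r Gamma1 divr1.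
  have v0 : Gamma a * v 0%N m = grid_shape a m.
    by rewrite /v expr0 mulr0 add0r mul1r mulrA divff ?mul1r// gt_eqF.
  move=> /hy /le_trans; apply; rewrite /e u0 v0 mulr1 lerD2l.
  by rewrite mulr_sumr ler_sum// => j _; rewrite /L mulrA.
apply: le_trans (volterra_gronwall L0 Le ye (ltnSn n) nN) _.
rewrite big_split/= -!mulr_sumr; apply: lerD; apply: ler_wpM2l => //.
  by apply: mittag_leffler_ge_sum => //; rewrite mulr_ge0 ?powR_ge0.
rewrite -mulrA ler_wpM2l ?(ltW Ga)// -mulr_suml ler_wpM2r//.
by apply: mittag_leffler_ge_sum => //; rewrite mulr_ge0 ?powR_ge0.
Qed.

Lemma L1_scaled_le (R : realType) (a tau G Z X : R) : 0 < tau -> 0 < G ->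
  tau `^ (- a) / G * Z <= X -> Z <= tau `^ a * G * X.
Proof.
move=> tau0 G0 h; have t0 : 0 < tau `^ a by rewrite powR_gt0.
have := ler_wpM2l (ltW (mulr_gt0 t0 G0)) h; apply: le_trans.
rewrite powRN le_eqVlt; apply/orP; left; apply/eqP; field.
by rewrite !gt_eqF.
Qed.

Lemma le_quotient_of_le (R : realType) (D u Z Q : R) :
  0 < D -> D <= u -> 0 <= Q -> u * Z <= Q -> Z <= Q / D.
Proof.
move=> D0 Du Q0 h; have [Z0|Z0] := leP Z 0.
  by rewrite (le_trans Z0)// divr_ge0// ltW.
by rewrite ler_pdivlMr// (le_trans _ h)// mulrC ler_pM2r.
Qed.

Lemma L1_volterra (R : realType) (a c l0 l1 r G : R) (y F : nat -> R) (n : nat) :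
  0 < a < 1 -> 0 <= c -> 0 <= l0 -> 0 <= l1 -> (0 < n)%N ->
  (forall m, (m <= n)%N -> 0 <= y m) -> (forall m, (m <= n)%N -> 0 <= F m) ->
  c * \sum_(0 <= k < n) (n - k)%:R `^ (a - 1) * F k.+1 <= G ->
  (forall m, (1 <= m <= n)%N -> y m - \sum_(0 <= k < m)
      (L1_weight a (m - k - 1) - L1_weight a (m - k)) * y k
      <= L1_weight a m * r + c * (l0 * y m + l1 * y (m - 1)%N + F m)) ->
  exists2 p, 0 <= p <= n%:R `^ (a - 1) &
    (1 - c * l0) * y n <= p * y 0%N + r * (1 - p)
      - c * l0 * (n%:R `^ (a - 1) * y 0%N)
      + (2 * (c * Num.max l0 l1 *
           \sum_(0 <= j < n) (n - j)%:R `^ (a - 1) * y j) + G).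
Proof.
move=> a01 c0 l00 l10 n0 y0 F0 hG hr; have /andP[_ a1] := a01.
have [P [P0 Pb PL1 yE]] := L1_inverse_kernel a01.
have Pn := Pb n; exists (P n).
  move/andP: Pn => [-> /le_trans]; apply.
  by apply: le0r_powR; rewrite ?subr_le0 ?(ltW a1) ?ltr0n ?ler_nat.
have P_ge0 m : 0 <= P m by have /andP[] := Pb m.
have := @L1_inverse_bound _ _ _ _ (fun m => c * (l0 * y m + l1 * y (m - 1)%N + F m))
  _ _ P_ge0 (yE y n) hr.
have -> : \sum_(k < n) P k * L1_weight a (n - k) = 1 - P n.
  by rewrite -(PL1 n) /conv big_ord_recr/= subnn L1_weight0// mulr1 addrK.
have := L1_absorb (ltW a1) c0 l00 l10 n0 P0 Pb y0 F0 hG.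
lra.
Qed.

Lemma L1_volterra_RL (R : realType) (a c D l0 l1 G : R) (y F : nat -> R) (n : nat) :
  0 < a < 1 -> 0 <= c -> 0 <= l0 -> 0 <= l1 -> 0 < D <= 1 - c * l0 -> (0 < n)%N ->
  (forall m, (m <= n)%N -> 0 <= y m) -> (forall m, (m <= n)%N -> 0 <= F m) ->
  c * \sum_(0 <= k < n) (n - k)%:R `^ (a - 1) * F k.+1 <= G ->
  (forall m, (1 <= m <= n)%N -> y m - \sum_(0 <= k < m)
      (L1_weight a (m - k - 1) - L1_weight a (m - k)) * y k
      <= c * (l0 * y m + l1 * y (m - 1)%N + F m)) ->
  y n <= n%:R `^ (a - 1) * y 0%N + (2 * (c * Num.max l0 l1 *
           \sum_(0 <= j < n) (n - j)%:R `^ (a - 1) * y j) + G) / D.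
Proof.
move=> a01 c0 l00 l10 /andP[D0 Du] n0 y0 F0 hG hr.
have [m mn|p /andP[p0 pn]] := L1_volterra (r := 0) a01 c0 l00 l10 n0 y0 F0 hG.
  by rewrite mulr0 add0r; exact: hr.
have G0 : 0 <= G.
  apply: le_trans hG; rewrite mulr_ge0// big_mkord; apply: sumr_ge0 => k _.
  by rewrite mulr_ge0 ?powR_ge0// F0.
set S := \sum_(0 <= j < n) _.
have S0 : 0 <= S.
  rewrite /S big_mkord; apply: sumr_ge0 => k _.
  by rewrite mulr_ge0 ?powR_ge0// y0// ltnW.
rewrite mul0r addr0 => h; rewrite -lerBlDl; apply: (le_quotient_of_le D0 Du).
  by rewrite addr_ge0// !mulr_ge0// le_max l00.
have := ler_wpM2r (y0 0%N isT) pn; lra.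
Qed.

Lemma L1_volterra_Caputo (R : realType) (a c D l0 l1 G : R) (y F : nat -> R) (n : nat) :
  0 < a < 1 -> 0 <= c -> 0 <= l0 -> 0 <= l1 -> 0 < D <= 1 - c * l0 -> (0 < n)%N ->
  (forall m, (m <= n)%N -> 0 <= y m) -> (forall m, (m <= n)%N -> 0 <= F m) ->
  c * \sum_(0 <= k < n) (n - k)%:R `^ (a - 1) * F k.+1 <= G ->
  (forall m, (1 <= m <= n)%N -> y m - L1_weight a (m - 1) * y 0%N
      - \sum_(1 <= k < m) (L1_weight a (m - k - 1) - L1_weight a (m - k)) * y k
      <= c * (l0 * y m + l1 * y (m - 1)%N + F m)) ->
  y n <= y 0%N / D + (2 * (c * Num.max l0 l1 *
           \sum_(0 <= j < n) (n - j)%:R `^ (a - 1) * y j) + G) / D.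
Proof.
move=> a01 c0 l00 l10 /andP[D0 Du] n0 y0 F0 hG hr.
have [m mn|p /andP[p0 pn]] := L1_volterra (r := y 0%N) a01 c0 l00 l10 n0 y0 F0 hG.
  by have /andP[m0 _] := mn; have := hr m mn; rewrite [X in _ -> _ - X <= _]big_ltn// subn0; lra.
set S := \sum_(0 <= j < n) _ => h.
rewrite -mulrDl ler_pdivlMr// mulrC (le_trans (ler_wpM2r (y0 n (leqnn n)) Du))//.
have : 0 <= c * l0 * (n%:R `^ (a - 1) * y 0%N).
  by rewrite !mulr_ge0 ?powR_ge0// y0.
lra.
Qed.

Lemma volterra_constants (R : realType) (t g1 g2 D lam S F1 F2 h : R) :
  0 < g1 -> 0 < D ->
  (2 * (t * g2 * lam * S) + g1 * g2 * (F1 + h * F2)) / D =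
  g1 * g2 / D * F1 + g1 * g2 / D * F2 * h + 2 * lam * (g1 * g2 / D) * t / g1 * S.
Proof. by move=> g10 D0; field; rewrite !gt_eqF. Qed.

Theorem lemma9 (R : realType) (alpha tau : R) (N : nat)
    (lambda0 lambda1 F1 F2 : R) (y F : nat -> R) (tau0 M : R)
    (halpha0 : 0 < alpha) (halpha1 : alpha < 1) (htau : 0 < tau)
    (hlambda0 : 0 <= lambda0) (hlambda1 : 0 <= lambda1)
    (hF1 : 0 <= F1) (hF2 : 0 <= F2)
    (hy : forall n : nat, (n <= N)%N -> 0 <= y n)
    (hF : forall n : nat, (n <= N)%N -> 0 <= F n)
    (hsum : forall n : nat, (1 <= n <= N)%N ->
       tau `^ alpha / Gamma alpha *
         \sum_(0 <= k < n) (n - k)%:R `^ (alpha - 1) * F k.+1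
       <= F1 + grid_pow alpha tau n * F2)
    (htau0_gt0 : 0 < tau0) (hM_gt0 : 0 < M)
    (htau0 : (tau0%:E < step_bound alpha lambda0)%E)
    (hM : M = Gamma alpha * Gamma (2 - alpha) /
              (1 - lambda0 * tau0 `^ alpha * Gamma (2 - alpha)))
    (htautau0 : tau < tau0) :
  ((forall n : nat, (1 <= n <= N)%N ->
      L1_RL alpha tau y n <= lambda0 * y n + lambda1 * y (n - 1)%N + F n) ->
   forall n : nat, (n <= N)%N ->
     y n <= (y 0%N * tau `^ (1 - alpha) + M * F2) * Gamma alpha *
              mittag_leffler alpha alpha
                (2 * Num.max lambda0 lambda1 * M * grid tau n `^ alpha) *
              grid_pow alpha tau n
            + M * mittag_leffler alpha 1
                    (2 * Num.max lambda0 lambda1 * M * grid tau n `^ alpha) * F1)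
  /\
  ((forall n : nat, (1 <= n <= N)%N ->
      L1_Caputo alpha tau y n <= lambda0 * y n + lambda1 * y (n - 1)%N + F n) ->
   forall n : nat, (n <= N)%N ->
     y n <= M * Gamma alpha *
              mittag_leffler alpha alpha
                (2 * Num.max lambda0 lambda1 * M * grid tau n `^ alpha) *
              F2 * grid_pow alpha tau n
            + mittag_leffler alpha 1
                (2 * Num.max lambda0 lambda1 * M * grid tau n `^ alpha) /
              (1 - lambda0 * tau0 `^ alpha * Gamma (2 - alpha)) *
              (y 0%N + Gamma alpha * Gamma (2 - alpha) * F1)).
Proof.
have alpha01 : 0 < alpha < 1 by rewrite halpha0.
have a20 : 0 < 2 - alpha by rewrite subr_gt0 (lt_trans halpha1)// ltr1n.
have G2 := Gamma_gt0 a20; have Ga := Gamma_gt0 halpha0.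
have ta : 0 < tau `^ alpha by rewrite powR_gt0.
have tau1 : tau `^ (1 - alpha) * tau `^ (alpha - 1) = 1.
  by rewrite -powRD ?(gt_eqF htau) ?implybT// addrA subrK subrr powRr0.
have tau2 : 0 <= tau `^ (alpha - 1) by exact: powR_ge0.
set lam := Num.max lambda0 lambda1.
have lam0 : 0 <= lam by rewrite le_max hlambda0.
move: hM; set D := 1 - _; move=> hM'.
have D0 : 0 < D.
  by move: hM_gt0; rewrite hM' (pmulr_rgt0 _ (mulr_gt0 Ga G2)) invr_gt0.
have Du : 0 < D <= 1 - tau `^ alpha * Gamma (2 - alpha) * lambda0.
  rewrite D0 /D /= lerD2l lerN2 mulrC mulrA; apply: ler_wpM2r; first exact: ltW.
  by rewrite ler_wpM2l//; apply: ge0_ler_powR; rewrite ?nnegrE// ltW.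
have D1 : D <= 1.
  rewrite /D gerBl; apply: mulr_ge0; last exact: ltW.
  by rewrite mulr_ge0 ?powR_ge0.
have G12 : 0 <= Gamma alpha * Gamma (2 - alpha) := ltW (mulr_gt0 Ga G2).
have hsum' n : (1 <= n <= N)%N -> tau `^ alpha * Gamma (2 - alpha) *
    \sum_(0 <= k < n) (n - k)%:R `^ (alpha - 1) * F k.+1 <=
    Gamma alpha * Gamma (2 - alpha) * (F1 + grid_pow alpha tau n * F2).
  move=> /hsum /(ler_wpM2l G12); apply: le_trans.
  move: (Gamma alpha) (Gamma _) Ga => x1 x2 x1_gt0.
  by rewrite le_eqVlt; apply/orP; left; apply/eqP; field; rewrite gt_eqF.
have volt := fun S h => volterra_constants (tau `^ alpha) (Gamma (2 - alpha))
  lam S F1 F2 h Ga D0.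
rewrite -hM' in volt.
have y00 : 0 <= y 0%N by exact: hy.
have MF2 : 0 <= M * F2 by rewrite mulr_ge0// ltW.
have MF1 : 0 <= M * F1 by rewrite mulr_ge0// ltW.
have w0 : 0 <= 2 * lam * M * tau `^ alpha by rewrite !mulr_ge0// ltW.
have zE n : 2 * lam * M * grid tau n `^ alpha =
    2 * lam * M * tau `^ alpha * n%:R `^ alpha.
  by rewrite /grid powRM ?(ltW htau)// mulrA.
have gridE n : grid_pow alpha tau n = tau `^ (alpha - 1) * grid_shape alpha n.
  by [].
have shapeE n : (0 < n)%N -> grid_shape alpha n = n%:R `^ (alpha - 1).
  by move=> n0; rewrite /grid_shape gtn_eqF.
have leN m n : (n <= N)%N -> (m <= n)%N -> (m <= N)%N.
  by move=> nN mn; exact: leq_trans nN.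
split=> hL1 n nN; rewrite zE gridE.
- have hB : 0 <= (y 0%N * tau `^ (1 - alpha) + M * F2) * tau `^ (alpha - 1).
    by rewrite mulr_ge0// addr_ge0// mulr_ge0 ?powR_ge0.
  apply: le_trans (mittag_leffler_gronwall alpha01 w0 MF1 hB _ nN) _; last first.
    move: (Gamma alpha) (mittag_leffler _ _ _) (mittag_leffler _ _ _) => x1 x2 x3.
    by rewrite le_eqVlt; apply/orP; left; apply/eqP; ring.
  move=> m mN; rewrite [(_ + M * F2) * _]mulrDl -mulrA tau1 mulr1.
  case: (posnP m) => [->|m0].
    rewrite big_geq// mulr0 addr0 mulr1 addrCA lerDl.
    by rewrite addr_ge0// mulr_ge0.
  have m1N : (1 <= m <= N)%N by rewrite m0.
  have := L1_volterra_RL alpha01 (ltW (mulr_gt0 ta G2)) hlambda0 hlambda1 Du m0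
    (fun k km => hy k (leN k m mN km)) (fun k km => hF k (leN k m mN km)) (hsum' m m1N).
  rewrite volt gridE shapeE// => h.
  apply: le_trans (h _) _.
    move=> k /andP[k1 km]; apply: L1_scaled_le htau G2 (hL1 k _).
    by rewrite k1 (leN k m).
  by rewrite le_eqVlt; apply/orP; left; apply/eqP; ring.
- have hA : 0 <= y 0%N / D + M * F1 by rewrite addr_ge0// divr_ge0// ltW.
  have hB : 0 <= M * F2 * tau `^ (alpha - 1) by rewrite mulr_ge0.
  apply: le_trans (mittag_leffler_gronwall alpha01 w0 hA hB _ nN) _; last first.
    move: (mittag_leffler _ _ _) (mittag_leffler _ _ _) => E1 E2; rewrite hM'.
    move: (Gamma _) (Gamma alpha) (D) D0 => g2 g1 D' D'0.
    by rewrite le_eqVlt; apply/orP; left; apply/eqP; field; rewrite gt_eqF.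
  move=> m mN; case: (posnP m) => [->|m0].
    rewrite big_geq// mulr0 addr0 mulr1 -addrA.
    apply: le_trans (_ : y 0%N / D <= _); last by rewrite lerDl addr_ge0.
    by rewrite ler_pdivlMr// ler_piMr.
  have m1N : (1 <= m <= N)%N by rewrite m0.
  have := L1_volterra_Caputo alpha01 (ltW (mulr_gt0 ta G2)) hlambda0 hlambda1 Du m0
    (fun k km => hy k (leN k m mN km)) (fun k km => hF k (leN k m mN km)) (hsum' m m1N).
  rewrite volt gridE shapeE// => h.
  apply: le_trans (h _) _.
    move=> k /andP[k1 km]; apply: L1_scaled_le htau G2 (hL1 k _).
    by rewrite k1 (leN k m).
  by rewrite le_eqVlt; apply/orP; left; apply/eqP; ring.
Qed.
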